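(* Let $\mathcal{X}\subseteq\mathbb{R}^n$ be nonempty, closed and convex, and let $a_0\in\mathbb{R}^n$. Let $\mathcal{V}\subset\mathbb{R}^n$ be convex, compact, smooth and strictly convex with $0\in\mathrm{int}(\mathcal{V})$. Let $\varphi(\cdot)=g\circ\|\cdot\|_{\mathcal{V}^{\circ}}$, where $g:\mathbb{R}\to\mathbb{R}_+$ is Legendre with $g(0)=0$ and $\nabla g(0)=0$. Consider the robust problem (RC) $\min_{x\in\mathcal{X}}\max_{\xi:\|\xi\|_{\mathcal{V}}\le r}\langle a_0+\xi,x\rangle$ and the deterministic problem (P) $\min_{x\in\mathcal{X}}\langle a_0,x\rangle$. Denote by $\mathcal{P}'(\mathcal{V})=\{x_{\mathrm{R}}'(\omega,\mathcal{V}):\omega\in[0,\infty)\}$ the (characterizable) robust path of (RC). Define $x_{\mathrm{R}}=\lim_{\omega\to\infty}x_{\mathrm{R}}'(\omega,\mathcal{V})=\arg\min_{x\in\mathcal{X}}\varphi(x)$. Denote by $\{x_{\mathrm{CP}}(\omega):\omega\in[0,\infty)\}$ the central path for solving (P), using $\varphi$ as the distance-generating function and initialized at $x_{\mathrm{R}}$. Denote by $\{x_k\}$ the proximal path for solving (P), using $\varphi$ as the distance-generating function, under a step-size sequence $\{\lambda_k>0:\sum_{k=0}^{\infty}\lambda_k^{-1}=\infty\}$ and initialized at $x_{\mathrm{R}}$. Then the three paths have the following Bregman projection interpretation: (Robust path) $\mathcal{P}'(\mathcal{V})=\left\{\Pi^{\varphi}_{\mathcal{X}}\left(\nabla\varphi^{*}\left(\nabla\varphi(0)-\omega^{-1}a_0\right)\right):\omega\in[0,\infty)\right\}$;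 (Central path) $\{x_{\mathrm{CP}}(\omega):\omega\in[0,\infty)\}=\left\{\Pi^{\varphi}_{\mathcal{X}}\left(\nabla\varphi^{*}\left(\nabla\varphi(x_{\mathrm{R}})-\omega^{-1}a_0\right)\right):\omega\in[0,\infty)\right\}$; (Proximal path) $x_{k+1}=\Pi^{\varphi}_{\mathcal{X}}\left(\nabla\varphi^{*}\left(\nabla\varphi(x_k)-\lambda_k^{-1}a_0\right)\right)$ for $k=0,1,\dots$, with $x_0=x_{\mathrm{R}}$.
   Context: Notation: $\mathbb{R}_+=[0,+\infty]$; $\mathrm{dom}$, $\mathrm{int}$ and $\mathrm{bd}$ denote effective domain, interior and boundary; $\psi^*$ is the convex conjugate of $\psi$. For a closed convex set $\mathcal{C}\subseteq\mathbb{R}^n$ containing $0$, the gauge is $\|v\|_{\mathcal{C}}=\inf\{t\ge0:v\in t\mathcal{C}\}$ and the polar is $\mathcal{C}^{\circ}=\{y\in\mathbb{R}^n:\langle x,y\rangle\le1\ \forall x\in\mathcal{C}\}$. A convex set $\mathcal{C}$ with nonempty interior is strictly convex if for any distinct $x,y\in\mathrm{bd}(\mathcal{C})$, $\{\alpha x+(1-\alpha)y:\alpha\in(0,1)\}\subset\mathrm{int}(\mathcal{C})$; it is smooth if the supporting hyperplane at each boundary point is unique. A proper, closed and convex function $\psi$ with values in $\mathbb{R}\cup\{+\infty\}$ is Legendre if (i) $\mathrm{int}(\mathrm{dom}(\psi))\ne\varnothing$; (ii) $\psi$ is differentiable on $\mathrm{int}(\mathrm{dom}(\psi))$; (iii)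 $\|\nabla\psi(x_n)\|_2\to+\infty$ for any sequence $(x_n)\subset\mathrm{int}(\mathrm{dom}(\psi))$ with $x_n\to x\in\mathrm{bd}(\mathrm{dom}(\psi))$; (iv) $\psi$ is strictly convex on $\mathrm{int}(\mathrm{dom}(\psi))$. The Bregman divergence of $\psi$ (proper closed convex, differentiable on $\mathrm{int}(\mathrm{dom}(\psi))$) is $D_\psi(x,y)=\psi(x)-\psi(y)-\langle\nabla\psi(y),x-y\rangle$ for $x\in\mathbb{R}^n$, $y\in\mathrm{int}(\mathrm{dom}(\psi))$. The Bregman projection of $y\in\mathrm{int}(\mathrm{dom}(\psi))$ onto a closed convex set $\mathcal{S}\subset\mathrm{int}(\mathrm{dom}(\psi))$ is $\Pi^{\psi}_{\mathcal{S}}(y)=\arg\min_{x\in\mathcal{S}}D_\psi(x,y)$. Points of the robust path: $x_{\mathrm{R}}'(\omega,\mathcal{V})=\arg\min_{x\in\mathcal{X}}\langle a_0,x\rangle+\omega\varphi(x)$, with the efficient solution $x_{\mathrm{E}}=\lim_{\omega\to0}x_{\mathrm{R}}'(\omega,\mathcal{V})=\arg\min_{x\in\mathcal{X}}\langle a_0,x\rangle$. Central path with distance-generating function $\psi$, initialized at $x_0$: $x_{\mathrm{CP}}(\omega)=\arg\min_{x\in\mathcal{X}}\langle a_0,x\rangle+\omega D_\psi(x,x_0)$, $\omega\in[0,\infty)$. Proximal path with distance-generating function $\psi$, step sizes $\{\lambda_k>0\}$ and starting point $x_0\in\mathcal{X}$: the sequence $x_{k+1}=\arg\min_{x\in\mathcal{X}}\langle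 a_0,x\rangle+\lambda_kD_\psi(x,x_k)$, $k=0,1,\dots$. The Bregman divergences used are strictly convex, so the optimal solutions are unique and ''$=$'' is written in place of ''$\in$'' in the definitions of the central and proximal paths.
   Formalization: Each identity assumes that the point where ∇φ* is taken lies in int(dom φ* ) (all ω>0, resp. the given k), since Legendre alone leaves ∇φ* undefined, e.g. g(t)=√(1+t²)−1; X is assumed to meet int(dom φ), and path points at ω=0 are limits ω→0+. *)

(* Defs.v *)
From HB Require Import structures.
From mathcomp Require Import all_boot all_order all_algebra.
From mathcomp Require Import all_classical all_reals all_analysis.

Set Implicit Arguments.
Unset Strict Implicit.
Unset Printing Implicit Defensive.

Import Order.TTheory GRing.Theory Num.Theory.
Import numFieldTopology.Exports numFieldNormedType.Exports.

Local Open Scope classical_set_scope.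
Local Open Scope ring_scope.

Section ConvexFunctions.
Context {R : realType}.

Definition edom (T : Type) (f : T -> \bar R) : set T := [set x | (f x < +oo)%E].

Definition proper (T : Type) (f : T -> \bar R) : Prop :=
  (forall x, (-oo < f x)%E) /\ edom f !=set0.

Definition econvex (E : lmodType R) (f : E -> \bar R) : Prop :=
  forall (x y : E) (t : R), 0 <= t -> t <= 1 ->
    (f (t *: x + (1 - t) *: y)%R <= t%:E * f x + (1 - t)%:E * f y)%E.

Definition strictly_econvex_on (E : lmodType R) (D : set E) (f : E -> \bar R) : Prop :=
  forall (x y : E) (t : R), D x -> D y -> x != y -> 0 < t -> t < 1 ->
    (f (t *: x + (1 - t) *: y)%R < t%:E * f x + (1 - t)%:E * f y)%E.

Definition boundary (T : topologicalType) (A : set T) : set T := closure A `\` interior A.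

(* Legendre functions of one real variable: the gradient is the derivative and
   the Euclidean norm is the absolute value. [fine] only drops the +oo branch,
   which does not occur near a point of the interior of the domain. *)
Definition legendre (g : R -> \bar R) : Prop :=
  [/\ proper g, lower_semicontinuous g & econvex (g : R^o -> \bar R)] /\
  [/\ interior (edom g) !=set0,
      forall x, interior (edom g) x -> derivable (fine \o g) x 1,
      forall (u : R^nat) (x : R),
        (forall k, interior (edom g) (u k)) -> u @ \oo --> x -> boundary (edom g) x ->
        `|derive1 (fine \o g) (u k)| @[k --> \oo] --> +oo &
      strictly_econvex_on (interior (edom g) : set R^o) (g : R^o -> \bar R)].

(* Differentiability of an extended-valued f at x includes x lying in the
   interior of its domain. *)
Definition has_derivative (f : R -> \bar R) (x d : R) : Prop :=
  interior (edom f) x /\ is_derive x 1 (fine \o f) d.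

End ConvexFunctions.

Section EuclideanSpace.
Context {R : realType} {n : nat}.
Local Notation E := 'rV[R]_n.

Definition dot (x y : E) : R := \sum_(i < n) x 0 i * y 0 i.

(* [inf] is real-valued: this is the gauge at every v lying in some t *: C, thus
   everywhere when C is a neighbourhood of 0. *)
Definition gauge (C : set E) (v : E) : R :=
  inf [set t : R | 0 <= t /\ exists2 c, C c & v = t *: c].

Definition polar (C : set E) : set E :=
  [set y | forall x, C x -> dot x y <= 1].

Definition strictly_convex (C : set E) : Prop :=
  [/\ @convex_set R E C, interior C !=set0 &
      forall x y, boundary C x -> boundary C y -> x != y ->
        forall t : R, 0 < t -> t < 1 -> interior C (t *: x + (1 - t) *: y)].

Definition supporting_hyperplane (C : set E) (x : E) (H : set E) : Prop :=
  exists p : E, [/\ p != 0, H = [set y | dot p y = dot p x] &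
                    forall y, C y -> dot p y <= dot p x].

Definition smooth (C : set E) : Prop :=
  forall x, boundary C x -> exists! H, supporting_hyperplane C x H.

Definition conjugate (psi : E -> \bar R) (u : E) : \bar R :=
  ereal_sup [set ((dot u x)%:E - psi x)%E | x in [set: E]].

(* Total function, to be used at points of differentiability in the interior of
   the domain. *)
Definition gradient (psi : E -> \bar R) (x : E) : E :=
  \row_i 'D_(delta_mx 0 i) (fine \o psi) x.

Definition argmin (S : set E) (f : E -> \bar R) : set E :=
  [set x | S x /\ forall z, S z -> (f x <= f z)%E].

Definition bregman (psi : E -> \bar R) (x y : E) : \bar R :=
  (psi x - psi y - (dot (gradient psi y) (x - y))%:E)%E.

(* Empty when y is not in the interior of the domain, where the projection is
   not defined. *)
Definition bregman_proj (psi : E -> \bar R) (S : set E) (y : E) : set E :=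
  [set x | interior (edom psi) y /\ argmin S (fun z => bregman psi z y) x].

(* A path is given by its solution set P w at each parameter w > 0; it converges
   to x along F when P w is eventually a single point, tending to x. *)
Definition path_limit (F : set_system R) (P : R -> set E) (x : E) : Prop :=
  exists s : R -> E, (\forall w \near F, P w = [set s w]) /\ s @ F --> x.

(* The set of points for w in [0, +oo[; the point at w = 0 is by convention the
   limit for w -> 0+, since the defining problem may have many solutions at
   w = 0 and w^-1 is then meaningless. *)
Definition path_points (P : R -> set E) : set E :=
  [set x | (exists2 w, 0 < w & P w x) \/ path_limit 0^'+ P x].

Definition robust_path (X : set E) (a0 : E) (phi : E -> \bar R) (w : R) : set E :=
  argmin X (fun x => (dot a0 x)%:E + w%:E * phi x)%E.

(* The central path initialised at x0, and also one proximal step from x0. *)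
Definition central_path (X : set E) (a0 : E) (psi : E -> \bar R) (x0 : E) (w : R) :
    set E :=
  argmin X (fun x => (dot a0 x)%:E + w%:E * bregman psi x x0)%E.

Definition proximal_path (X : set E) (a0 : E) (psi : E -> \bar R) (lam : R^nat)
    (x0 : E) (x : nat -> E) : Prop :=
  x 0%N = x0 /\ forall k, central_path X a0 psi (x k) (lam k) (x k.+1).

End EuclideanSpace.

(* Main.v *)
Require Import Defs.
From mathcomp Require Import all_boot all_order all_algebra.
From mathcomp Require Import all_classical all_reals all_analysis.
From mathcomp Require Import ring lra.
Set Implicit Arguments.
Unset Strict Implicit.
Unset Printing Implicit Defensive.
Import Order.TTheory GRing.Theory Num.Theory.
Import numFieldTopology.Exports numFieldNormedType.Exports.
Local Open Scope classical_set_scope.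
Local Open Scope ring_scope.

(** Every problem in the statement minimizes [phi] minus a linear form over [X].
    Up to a positive factor and an additive constant, the robust objective at
    [w] is [phi - <u, .>] with [u = - a0 / w], and a central or proximal step
    from [x0] has the same form with [u = gradient phi x0 - a0 / w]
    ([robust_path_tilt], [central_path_tilt]); the Bregman divergence from [y]
    is of this form with [u = gradient phi y] ([bregman_proj_tilt]).  The
    projection formulas therefore reduce to [gradient phi 0 = 0] and to the
    inversion formula [gradient phi (gradient phi^* u) = u] for [u] interior to
    the domain of [phi^*] ([gradient_legendre_gaugeK]); then both sides have the
    same solution set at every parameter [w > 0], so the same limit at 0.

    For the inversion formula, [phi - <u, .>] is coercive when [u] is interior to
    the domain of [phi^*] ([tilt_coercive]), hence has a minimizer [x].  It is
    the only one because [phi] is strictly convex on its domain, and a function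
    whose tilt has a unique minimizer [x] has a conjugate with gradient [x] at
    [u] ([conjugate_dirder]).  The minimizer lies in the interior of the domain
    because [g] is steep ([argmin_legendre_gauge_interior]), so the first-order
    condition there reads [gradient phi x = u].

    The required properties of [phi] come from the geometry of [V].  The gauge
    of the polar is the support function of [V] ([gauge_polar_max]).  Smoothness
    of [V] makes it strictly convex between distinct points of equal gauge
    ([gauge_polar_strict]), and strict monotonicity and strict convexity of [g]
    on the half-line do the rest.  Strict convexity of [V] makes maximizers of
    linear forms on [V] unique, so the gauge is differentiable off the origin:
    this is [conjugate_dirder] again, the support function being the conjugate
    of the indicator of [V].

    Both the differentiability of conjugates and the limit [w -> +oo] of the
    robust path rest on [strict_min_growth]: a convex lower semicontinuous
    function grows at least linearly outside every ball around a strict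
    minimizer, so that a small linear perturbation neither destroys the
    existence of a minimizer nor moves it far. *)

(** * Scalar products and directional derivatives *)

Section DotProduct.
Context {R : realType} {n : nat}.
Implicit Types x y z : 'rV[R]_n.

Lemma dotC x y : dot x y = dot y x.
Proof. by apply: eq_bigr => i _; rewrite mulrC. Qed.

Lemma dotDr x y z : dot x (y + z) = dot x y + dot x z.
Proof. by rewrite -big_split; apply: eq_bigr => i _; rewrite mxE mulrDr. Qed.

Lemma dotZr (a : R) x y : dot x (a *: y) = a * dot x y.
Proof. by rewrite [RHS]big_distrr; apply: eq_bigr => i _; rewrite mxE /= mulrCA. Qed.

Lemma dotNr x y : dot x (- y) = - dot x y.
Proof. by rewrite -scaleN1r dotZr mulN1r. Qed.

Lemma dotBr x y z : dot x (y - z) = dot x y - dot x z.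
Proof. by rewrite dotDr dotNr. Qed.

Lemma dot0r x : dot x 0 = 0.
Proof. by rewrite -(scale0r 0) dotZr mul0r. Qed.

Lemma dotDl x y z : dot (x + y) z = dot x z + dot y z.
Proof. by rewrite dotC dotDr !(dotC z). Qed.

Lemma dotZl (a : R) x y : dot (a *: x) y = a * dot x y.
Proof. by rewrite dotC dotZr dotC. Qed.

Lemma dotBl x y z : dot (x - y) z = dot x z - dot y z.
Proof. by rewrite dotC dotBr !(dotC z). Qed.

Lemma dotNl x y : dot (- x) y = - dot x y.
Proof. by rewrite dotC dotNr dotC. Qed.

Lemma dot0l x : dot 0 x = 0.
Proof. by rewrite dotC dot0r. Qed.

Lemma dot_delta x i : dot x (delta_mx 0 i) = x 0 i.
Proof.
rewrite /dot (bigD1 i) //= big1 ?mxE ?eqxx ?mulr1 ?addr0 // => j ji.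
by rewrite mxE (negbTE ji) andbF mulr0.
Qed.

Lemma dot_self_gt0 x : x != 0 -> 0 < dot x x.
Proof.
move=> x0; rewrite lt_def sumr_ge0 ?andbT; last by move=> i _; rewrite -expr2 sqr_ge0.
apply: contra x0; rewrite psumr_eq0; last by move=> i _; rewrite -expr2 sqr_ge0.
move/allP => h; apply/eqP/rowP => i; rewrite mxE.
by have := h i (mem_index_enum i); rewrite /= mulf_eq0 orbb => /eqP.
Qed.

Lemma coord_le_norm x i : `|x 0 i| <= `|x|.
Proof.
rewrite [leRHS]/Num.Def.normr/= mx_normrE.
exact: (le_bigmax _ (fun ij => `|x ij.1 ij.2|) (ord0, i)).
Qed.

Lemma dot_le_norm x y : `|dot x y| <= n%:R * `|x| * `|y|.
Proof.
apply: le_trans (ler_norm_sum _ _ _) _.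
have -> : n%:R * `|x| * `|y| = \sum_(i < n) `|x| * `|y|.
  by rewrite sumr_const card_ord -mulrA mulr_natl.
by apply: ler_sum => i _; rewrite normrM ler_pM // coord_le_norm.
Qed.

Lemma dot_bounded x : exists2 C, 0 < C & forall y, `|dot x y| <= C * `|y|.
Proof.
exists (n%:R * `|x| + 1) => [|y]; first by rewrite ltr_wpDl // mulr_ge0.
by rewrite (le_trans (dot_le_norm x y)) // ler_wpM2r // lerDl.
Qed.

Lemma near_dist_le x (r : R) : 0 < r -> \forall z \near x, `|x - z| <= r.
Proof.
move=> r0; apply/nbhs_ballP; exists r => //= z.
by rewrite -ball_normE /= => /ltW.
Qed.

Lemma dot_continuous x : continuous (dot x).
Proof.
move=> y; apply/(@cvgrPdist_le _ R _ (nbhs y)) => e e0.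
have [C C0 hC] := dot_bounded x.
have : \forall z \near y, `|y - z| <= e / C.
  by apply: near_dist_le; exact: divr_gt0.
apply: filterS => z yz; rewrite -dotBr (le_trans (hC _)) //.
by rewrite -ler_pdivlMl // mulrC.
Qed.

(** The sup norm is attained at a coordinate, so finitely many scalar products
    with signed basis vectors control it. *)
Lemma norm_le_dot x : 0 < `|x| ->
  exists i, exists2 s : R, `|s| = 1 & `|x| = dot x (s *: delta_mx 0 i).
Proof.
move=> x0.
have [[i j] /= Hi] := mx_norm_neq0 (lt0r_neq0 x0).
exists j, (Num.sg (x 0 j)).
  rewrite normr_sg; case: eqP => // x0j; move: x0.
  by rewrite -[`|x|]/(mx_norm x) Hi ord1 x0j normr0 ltxx.
by rewrite dotZr dot_delta -normrEsg -[LHS]/(mx_norm x) Hi ord1.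
Qed.

End DotProduct.

Section DirectionalDerivative.
Context {R : realType}.

(** The first-order expansion equivalent to [is_derive]: the estimates below come
    as inequalities, from which it is read off without forming quotients. *)
Definition dirder (U : normedModType R) (f : U -> R) (x v : U) (d : R) : Prop :=
  forall e, 0 < e ->
    \forall t \near (0 : R), `|f (t *: v + x) - f x - t * d| <= e * `|t|.

Lemma is_derive_dirder (U : normedModType R) (f : U -> R) x v d :
  is_derive x v f d <-> dirder f x v d.
Proof.
have quotientE (t a : R) : t != 0 -> `|t^-1 * a - d| * `|t| = `|a - t * d|.
  by move=> t0; rewrite -normrM mulrBl mulrAC mulVf // mul1r (mulrC d).
split=> [[df <-] e e0|H].
  have /eqolimP := df; move=> /eqaddoP /(_ e e0).
  rewrite /= near_withinE; apply: filter_app; near=> t => h.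
  have [->|t0] := eqVneq t 0.
    by rewrite scale0r add0r subrr mul0r subrr !normr0 mulr0.
  have := h t0; rewrite /= -![(_ - _ : _ -> _) _]/(_ - _) /cst /= normr1 mulr1.
  rewrite -[_ *: (_ - _)]/(_ * (_ - _)).
  by rewrite -(ler_pM2r (_ : 0 < `|t|)) ?normr_gt0 // -normrM mulrBl
    mulrAC mulVf // mul1r (mulrC _ t).
have cv : (fun h => h^-1 *: ((f \o shift x) (h *: v) - f x)) @ 0^' --> d.
  apply/cvgrPdist_le => e e0; rewrite near_withinE.
  apply: filterS (H e e0) => t ht t0; rewrite /= distrC.
  rewrite -[_ *: (_ - _)]/(_ * (_ - _)).
  by rewrite -(ler_pM2r (_ : 0 < `|t|)) ?normr_gt0 // quotientE.
split; first by apply/cvg_ex; exists d.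
exact: cvg_lim cv.
Unshelve. all: by end_near. Qed.

(** The alternative [d = 0] allows [f] to have no derivative at [x], as happens to
    a gauge at the origin: a Lipschitz bound on [f] is then enough. *)
Lemma dirder_comp (U : normedModType R) (f : U -> R) (G : R -> R) x v d m C :
  dirder G (f x) 1 d -> (forall t, `|f (t *: v + x) - f x| <= C * `|t|) ->
  d = 0 \/ dirder f x v m -> dirder (G \o f) x v (d * m).
Proof.
move=> dG lipf df e e0; pose c : R := `|C| + 1.
have c0 : 0 < c by rewrite ltr_wpDl.
have lip t : `|f (t *: v + x) - f x| <= c * `|t|.
  rewrite (le_trans (lipf t)) // ler_wpM2r //.
  by rewrite (le_trans (ler_norm _)) // lerDl.
have e2 : 0 < e / 2 / c by rewrite !divr_gt0.
have /nbhs_ballP[r /= r0 dGr] := dG _ e2.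
have near_lin : \forall t \near (0 : R),
    `|d| * `|f (t *: v + x) - f x - t * m| <= e / 2 * `|t|.
  case: df => [->|/(_ (e / 2 / (`|d| + 1)))].
    by apply: filterE => t; rewrite normr0 mul0r mulr_ge0 // divr_ge0 // ltW.
  rewrite !divr_gt0 ?ltr_wpDl // => /(_ isT); apply: filterS => t ht.
  rewrite (@le_trans _ _ ((`|d| + 1) * (e / 2 / (`|d| + 1) * `|t|))) //.
    by rewrite ler_pM // lerDl.
  by rewrite mulrA (mulrC (`|d| + 1)) divfK // lt0r_neq0 // ltr_wpDl.
have near_s : \forall t \near (0 : R), `|t| < r / c.
  by apply: nbhs0_lt; rewrite divr_gt0.
apply: filterS (filterI near_lin near_s) => t [lin_t ts].
have st : `|f (t *: v + x) - f x| < r.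
  by rewrite (le_lt_trans (lip t)) // mulrC -ltr_pdivlMr.
have := dGr (f (t *: v + x) - f x); rewrite -ball_normE /= sub0r normrN => /(_ st).
rewrite [_%:A]mulr1 subrK => h.
rewrite (_ : _ - _ - _ = (G (f (t *: v + x)) - G (f x) - (f (t *: v + x) - f x) * d)
   + d * (f (t *: v + x) - f x - t * m)); last by ring.
rewrite (le_trans (ler_normD _ _)) // (splitr e) [leRHS]mulrDl (normrM d) lerD //.
rewrite (le_trans h) // (le_trans (ler_wpM2l (ltW e2) (lip t))) //.
by rewrite mulrA divfK // lt0r_neq0.
Qed.

Lemma dirder_ge (U : normedModType R) (f : U -> R) x v d K (r : R) :
  0 < r -> dirder f x v d ->
  (forall t, 0 < t -> t < r -> t * K <= f (t *: v + x) - f x) -> K <= d.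
Proof.
move=> r0 H fK; apply/ler_addgt0Pr => e /H /nbhs_ballP[s /= s0 Hs].
pose t := Num.min r s / 2.
have m0 : 0 < Num.min r s by rewrite lt_min r0 s0.
have t0 : 0 < t by rewrite divr_gt0.
have tm : t < Num.min r s by rewrite ltr_pdivrMr // ltr_pMr // ltr1n.
have [tr ts] : t < r /\ t < s.
  by move: tm; rewrite lt_min => /andP.
have := Hs t; rewrite -ball_normE /= sub0r normrN gtr0_norm // => /(_ ts).
move=> /(le_trans (ler_norm _)); have := fK t t0 tr => h1 h2.
rewrite -(ler_pM2l t0); lra.
Qed.

Lemma dirder_le (U : normedModType R) (f : U -> R) x v d K (r : R) :
  0 < r -> dirder f x v d ->
  (forall t, 0 < t -> t < r -> f (t *: v + x) - f x <= t * K) -> d <= K.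
Proof.
move=> r0 H fK; rewrite -lerN2.
apply: (@dirder_ge U (fun y => - f y) x v _ _ r r0) => [e e0|t t0 tr].
  apply: filterS (H e e0) => t; rewrite -normrN; congr (`| _ | <= _); ring.
have := fK t t0 tr; lra.
Qed.

End DirectionalDerivative.

(** * Minimization of lower semicontinuous convex functions *)

Section Minimization.
Context {R : realType} {n : nat}.
Implicit Types (x y z u v e : 'rV[R]_n) (S K : set 'rV[R]_n) (psi : 'rV[R]_n -> \bar R).

(** Each point of [K] has a neighbourhood where [psi] stays above some [c + d], and
    compactness lets one [d] serve them all. *)
Lemma lsc_gap_compact K psi (c : R) :
  compact K -> lower_semicontinuous psi -> (forall x, K x -> (c%:E < psi x)%E) ->
  exists2 d : R, 0 < d & forall x, K x -> ((c + d)%:E <= psi x)%E.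
Proof.
move=> /compact_near_coveringP cK lpsi cpsi.
have : \forall d \near 0^'+, K `<=` [set x | ((c + d)%:E <= psi x)%E].
  apply: cK => x /cpsi cx.
  have [b cb bx] : exists2 b : R, c < b & (b%:E < psi x)%E.
    case: (psi x) cx => [r| |] //= cx.
      by exists ((c + r) / 2); rewrite ?lte_fin ?midf_lt // -lte_fin.
    by exists (c + 1); rewrite ?ltry // ltrDl.
  have [V xV Vb] := lpsi x b bx.
  exists (V, [set d | d <= b - c]).
    split => //=; apply: nbhs_right_le; lra.
  move=> [y d] /= [Vy dbc]; apply: le_trans (ltW (Vb _ Vy)).
  by rewrite lee_fin -lerBrDl.
move=> H.
have [d [d0 dK]] := @filter_ex _ _ _ _ (filterI (nbhs_right_gt 0) H).
by exists d => // x /dK.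
Qed.

Lemma closed_norm_preimage x (A : set R) :
  closed A -> closed [set y | A `|y - x|].
Proof.
move=> cA; apply: (@preimage_closed _ _ (fun y => `|y - x|) A) => // y _.
apply/(@cvgrPdist_le _ R _ (nbhs y)) => e e0.
apply: filterS (near_dist_le y e0) => z; apply: le_trans.
by rewrite (le_trans (ler_dist_dist _ _)) // opprB addrA subrK.
Qed.

Lemma bounded_compact x S (r : R) : closed S -> compact (S `&` [set y | `|y - x| <= r]).
Proof.
move=> cS; apply: bounded_closed_compact.
  exists (`|x| + r); split; first exact: num_real.
  move=> M rM y [_ /= yx]; apply: le_trans (ltW rM).
  rewrite -[y](subrK x); apply: le_trans (ler_normD _ _) _.
  by rewrite addrC lerD.
by apply: closedI => //; apply: (@closed_norm_preimage x [set s | s <= r]); exact: closed_le.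
Qed.

(** If the infimum were not attained, [lsc_gap_compact] would leave a gap above it
    on a large ball, while coercivity leaves one outside the ball. *)
Lemma lsc_argmin S psi (eta C : R) : closed S -> lower_semicontinuous psi ->
  0 < eta -> (forall x, S x -> ((eta * `|x| - C)%:E <= psi x)%E) ->
  (exists2 x, S x & (psi x < +oo)%E) -> argmin S psi !=set0.
Proof.
move=> cS lpsi eta0 coer [x0 Sx0 psix0].
pose m := ereal_inf (psi @` S).
have mlb x : S x -> (m <= psi x)%E by move=> Sx; apply: ereal_inf_lbound; exists x.
have m_fin : m \is a fin_num.
  rewrite fin_numElt (le_lt_trans (mlb _ Sx0)) // andbT.
  apply: (@lt_le_trans _ _ (- C)%:E); first exact: ltNyr.
  apply: le_ereal_inf_tmp => _ [x Sx <-]; apply: le_trans (coer x Sx).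
  by rewrite lee_fin lerDr mulr_ge0 // ltW.
apply: contrapT => noargmin.
have gt_m x : S x -> ((fine m)%:E < psi x)%E.
  move=> Sx; rewrite fineK // ltNge; apply/negP => xm; apply: noargmin.
  by exists x; split => // z /mlb; apply: le_trans.
pose r := (fine m + 1 + C) / eta.
have [d d0 hd] := lsc_gap_compact (@bounded_compact 0 _ r cS) lpsi
  (fun x h => gt_m x (proj1 h)).
suff : ((fine m + Num.min d 1)%:E <= m)%E.
  rewrite -{2}(fineK m_fin) lee_fin gerDl leNgt => /negP; apply.
  by rewrite lt_min d0 ltr01.
apply: le_ereal_inf_tmp => _ [x Sx <-].
have [xr|xr] := leP `|x| r.
  apply: (@le_trans _ _ (fine m + d)%:E).
    by rewrite lee_fin lerD2l ge_min lexx.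
  by apply: hd; split; rewrite //= subr0.
apply: le_trans (coer x Sx); rewrite lee_fin.
apply: (@le_trans _ _ (fine m + 1)); first by rewrite lerD2l ge_min lexx orbT.
by move: xr; rewrite ltr_pdivrMr // mulrC => /ltW; rewrite lerBrDr.
Qed.

(** On the sphere of radius [rho] around the strict minimizer, compactness gives a
    gap above the minimum; convexity along the segment from [x0] to a farther
    point propagates it proportionally to the distance. *)
Lemma strict_min_growth S psi x0 (c rho : R) :
  closed S -> @convex_set R 'rV[R]_n S -> lower_semicontinuous psi -> econvex psi ->
  S x0 -> psi x0 = c%:E -> (forall x, S x -> x != x0 -> (c%:E < psi x)%E) ->
  0 < rho ->
  exists2 d : R, 0 < d & forall x, S x -> rho <= `|x - x0| ->
    ((c + d * `|x - x0|)%:E <= psi x)%E.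
Proof.
move=> cS convS lpsi convpsi Sx0 psix0 strict rho0.
pose K := S `&` [set x | `|x - x0| = rho].
have cK : compact K.
  rewrite (_ : K = (S `&` [set x | `|x - x0| = rho]) `&` [set x | `|x - x0| <= rho]).
    by apply: bounded_compact; apply: closedI => //;
       apply: (@closed_norm_preimage x0 [set r | r = rho]); exact: closed_eq.
  by apply/seteqP; split=> x [] //= Sx xr; split=> //=; rewrite xr.
have [|d d0 hd] := lsc_gap_compact cK lpsi (c := c).
  move=> x [Sx /= xr]; apply: strict => //.
  by apply/eqP => xx0; move: xr rho0; rewrite xx0 subrr normr0 => <-; rewrite ltxx.
exists (d / rho) => [|x Sx xr]; first exact: divr_gt0.
have xx0 : 0 < `|x - x0| := lt_le_trans rho0 xr.
pose t := rho / `|x - x0|.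
have t0 : 0 < t by rewrite divr_gt0.
have t1 : t <= 1 by rewrite ler_pdivrMr // mul1r.
pose z := t *: x + (1 - t) *: x0.
have Kz : K z.
  split.
    have ti : 0 <= t <= 1 by rewrite t1 ltW.
    by have := @convS x x0 (Itv01 (ltW t0) t1); rewrite !inE; apply.
  rewrite /= /z scalerBl scale1r addrCA addrAC subrr add0r -scalerBr normrZ.
  by rewrite gtr0_norm // divfK // lt0r_neq0.
have := le_trans (hd z Kz) (convpsi x x0 t (ltW t0) t1).
rewrite psix0; have := strict x Sx; rewrite -subr_eq0 -normr_gt0 => /(_ xx0).
case: (psi x) => [p| |] //= _; last by rewrite leey.
rewrite -!EFinM -EFinD !lee_fin => h.
have {h} h : d <= t * (p - c) by lra.
have -> : p = c + t * (p - c) / rho * `|x - x0|.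
  by rewrite /t; field; rewrite !lt0r_neq0.
by rewrite lerD2l ler_wpM2r // ler_wpM2r // invr_ge0 ltW.
Qed.

End Minimization.

(** * Linear tilts and differentiability of the conjugate *)

Section Conjugate.
Context {R : realType} {n : nat}.
Implicit Types (x y z u v e : 'rV[R]_n) (S : set 'rV[R]_n) (psi : 'rV[R]_n -> \bar R).

(** Minimizing [tilt psi u] is the problem whose optimal value is
    [- conjugate psi u] and whose optimality condition is [u] in the
    subdifferential of [psi]. *)
Definition tilt psi u x : \bar R := (psi x - (dot u x)%:E)%E.

Lemma lsc_tilt psi u : lower_semicontinuous psi -> lower_semicontinuous (tilt psi u).
Proof.
move=> lpsi x a; rewrite /tilt lteBrDr // -EFinD => ax.
have [b ab bx] : exists2 b : R, a + dot u x < b & (b%:E < psi x)%E.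
  case: (psi x) ax => [r| |] //= ax.
    by exists ((a + dot u x + r) / 2); rewrite ?lte_fin ?midf_lt // -lte_fin.
  by exists (a + dot u x + 1); rewrite ?ltry // ltrDl.
have [V xV Vb] := lpsi x b bx.
have e0 : 0 < b - (a + dot u x) by rewrite subr_gt0.
have /cvgrPdist_lt /(_ _ e0) near_dot := @dot_continuous R n u x.
exists (V `&` [set z | `|dot u x - dot u z| < b - (a + dot u x)]).
  exact: filterI.
move=> z [Vz dz]; rewrite lteBrDr // -EFinD; apply: le_lt_trans (Vb _ Vz).
by rewrite lee_fin; move: dz; rewrite /= ltr_norml => /andP[? ?]; lra.
Qed.

Lemma econvex_tilt psi u : econvex psi -> econvex (tilt psi u).
Proof.
move=> cpsi x y t t0 t1; rewrite /tilt.
have distr (a q : R) (p : \bar R) : (a%:E * (p - q%:E) = a%:E * p - (a * q)%:E)%E.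
  by rewrite muleBr // fin_num_adde_defl.
rewrite !distr addeACA -oppeD // -EFinD dotDr !dotZr.
by apply: leeB => //; exact: cpsi.
Qed.

Lemma conjugate_ge psi u x : ((dot u x)%:E - psi x <= conjugate psi u)%E.
Proof. by apply: ereal_sup_ubound; exists x. Qed.

Lemma conjugate_le psi u (k : R) :
  (forall x, (- k%:E <= tilt psi u x)%E) -> (conjugate psi u <= k%:E)%E.
Proof.
move=> h; apply: ge_ereal_sup => _ [x _ <-]; have := h x; rewrite /tilt.
case: (psi x) => [p| |] //=; last by rewrite leNye.
by rewrite -?EFinN -?EFinD !lee_fin => {}h; lra.
Qed.

Lemma gradientP (f : 'rV[R]_n -> \bar R) x d :
  (forall e, dirder (fine \o f) x e (dot d e)) -> gradient f x = d.
Proof.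
move=> df; apply/rowP => i; rewrite mxE -[RHS]dot_delta.
by have /is_derive_dirder[_ ->] := df (delta_mx 0 i).
Qed.

Lemma conjugate_argmax psi u x0 (c : R) :
  psi x0 = c%:E -> (forall x, ((c - dot u x0)%:E <= tilt psi u x)%E) ->
  conjugate psi u = (dot u x0 - c)%:E.
Proof.
move=> psix0 h; apply/eqP; rewrite eq_le; apply/andP; split.
  by apply: conjugate_le => x; rewrite -EFinN opprB.
by have := conjugate_ge psi u x0; rewrite psix0.
Qed.

(** Evaluating at [x0] bounds [conjugate psi (u + t e)] from below by a function
    of slope [<x0, e>].  For the upper bound, points far from [x0] are ruled out
    by the growth at the strict minimizer once [t] is small, and the points at
    distance less than [rho] change the slope by at most [C * rho]. *)
Lemma conjugate_dirder psi u x0 (c : R) :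
  lower_semicontinuous psi -> econvex psi -> psi x0 = c%:E ->
  (forall x, x != x0 -> ((c - dot u x0)%:E < tilt psi u x)%E) ->
  forall e, dirder (fine \o conjugate psi) u e (dot x0 e).
Proof.
move=> lpsi cpsi psix0 strict e eps eps0.
have tx0 : tilt psi u x0 = (c - dot u x0)%:E by rewrite /tilt psix0.
have le_tilt x : ((c - dot u x0)%:E <= tilt psi u x)%E.
  by have [->|/strict/ltW //] := eqVneq x x0; rewrite tx0.
(* [rho = eps / C] makes the slope error [C * rho] of nearby points equal to [eps]. *)
have [C C0 hC] := dot_bounded e.
have rho0 : 0 < eps / C by rewrite divr_gt0.
have [d d0 hd] := strict_min_growth closedT (fun _ _ _ _ _ => mem_setT _)
  (@lsc_tilt psi u lpsi) (econvex_tilt u cpsi) I tx0 (fun x _ => strict x) rho0.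
rewrite /= (conjugate_argmax psix0 le_tilt) /=.
have dC0 : 0 < d / C by rewrite divr_gt0.
apply: filterS (nbhs0_le dC0) => t tdC.
have tC : `|t| * C <= d by rewrite -ler_pdivlMr.
have lb : ((dot u x0 - c + t * dot x0 e)%:E <= conjugate psi (t *: e + u))%E.
  apply: le_trans (conjugate_ge psi (t *: e + u) x0).
  by rewrite psix0 -EFinB lee_fin dotDl dotZl (dotC x0); lra.
have ub : (conjugate psi (t *: e + u) <=
    (dot u x0 - c + t * dot x0 e + eps * `|t|)%:E)%E.
  apply: conjugate_le => x; have := hd x I; have := le_tilt x; rewrite /tilt.
  rewrite !dotDl !dotZl (dotC x0).
  case: (psi x) => [p| |] //=; last by rewrite !leey.
  rewrite -?EFinN -?EFinD !lee_fin => px pgrow.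
  have tex : t * dot e x - t * dot e x0 <= `|t| * C * `|x - x0|.
    rewrite -mulrBr -dotBr (le_trans (ler_norm _)) // normrM -mulrA.
    by rewrite ler_wpM2l.
  have [/pgrow {}pgrow|xx0] := leP (eps / C) `|x - x0|.
    have := ler_wpM2r (normr_ge0 (x - x0)) tC.
    have := mulr_ge0 (ltW eps0) (normr_ge0 t); lra.
  have : `|t| * C * `|x - x0| <= `|t| * C * (eps / C).
    by rewrite ler_wpM2l ?mulr_ge0 // ltW.
  rewrite (_ : `|t| * C * (eps / C) = eps * `|t|); first by lra.
  by field; rewrite lt0r_neq0.
move: lb ub; case: (conjugate psi (t *: e + u)) => [r| |] //=.
rewrite !lee_fin => lb ub; rewrite ler_norml; apply/andP; split; lra.
Qed.

(** At the points [u + (r / 2) s e_i] ([s] a sign) near [u] the conjugate is still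
    finite; by the Fenchel inequality there, [tilt psi u x] exceeds
    [(r / 2) s x_i] up to a constant for every coordinate and sign. *)
Lemma tilt_coercive psi u : interior (edom (conjugate psi)) u ->
  exists2 eta : R, 0 < eta &
  exists C, forall x, ((eta * `|x| - C)%:E <= tilt psi u x)%E.
Proof.
move=> /nbhs_ballP[r /= r0 ur].
pose K w := `|fine (conjugate psi w)|.
have bound w x : edom (conjugate psi) w -> ((dot w x - K w)%:E <= psi x)%E.
  move=> dw.
  have : (conjugate psi w <= (K w)%:E)%E.
    move: dw; rewrite /K /edom /=; case: (conjugate psi w) => [q| |] //= _.
      by rewrite lee_fin ler_norm.
    by rewrite leNye.
  move=> /(le_trans (conjugate_ge _ _ x)).
  case: (psi x) => [p| |] //=; last by rewrite leey.
  by rewrite -?EFinN -?EFinD !lee_fin => {}h; lra.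
have eta0 : 0 < r / 2 by rewrite divr_gt0.
pose w (s : R) i := u + (r / 2 * s) *: delta_mx 0 i.
exists (r / 2) => //; exists (K u + \sum_i (K (w 1 i) + K (w (-1) i))) => x.
have Kge0 v : 0 <= K v by rewrite normr_ge0.
have sum_ge0 : 0 <= \sum_i (K (w 1 i) + K (w (-1) i)).
  by apply: sumr_ge0 => i _; rewrite addr_ge0.
have [x0|x0] := eqVneq `|x| 0.
  have := bound u x (ur _ (ballxx _ r0)).
  rewrite /tilt x0 mulr0; case: (psi x) => [p| |] //=; last by rewrite !leey.
  by rewrite -?EFinN -?EFinD !lee_fin => {}h; lra.
have [i [s s1 xs]] : exists i, exists2 s : R, `|s| = 1 & `|x| = dot x (s *: delta_mx 0 i).
  by apply: norm_le_dot; rewrite lt_def x0 normr_ge0.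
have domw : edom (conjugate psi) (w s i).
  apply: ur; rewrite -ball_normE /= opprD addNKr normrN normrZ normrM s1 mulr1.
  have d1 : `|delta_mx 0 i : 'rV[R]_n| <= 1.
    rewrite [leLHS]/Num.Def.normr/= mx_normrE; apply: bigmax_le => // j _.
    by rewrite mxE; case: (_ && _); rewrite /= ?normr1 ?normr0.
  rewrite (gtr0_norm eta0) (le_lt_trans (ler_wpM2l (ltW eta0) d1)) // mulr1.
  by rewrite ltr_pdivrMr // ltr_pMr // ltr1n.
have Ks : K (w s i) <= \sum_i (K (w 1 i) + K (w (-1) i)).
  rewrite (bigD1 i) //= ler_wpDr //; first by apply: sumr_ge0 => j _; rewrite addr_ge0.
  have [->|->] : s = 1 \/ s = -1; last 2 first.
  - by rewrite lerDl.
  - by rewrite lerDr.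
  by move/eqP: s1; rewrite eqr_norml => /andP[/orP[]/eqP-> _]; [left|right].
have := bound (w s i) x domw; rewrite /tilt.
rewrite {1}/w dotDl -scalerA dotZl (dotC (s *: _) x) -xs.
case: (psi x) => [p| |] //=; last by rewrite !leey.
by rewrite -?EFinN -?EFinD !lee_fin => h; have := Kge0 u; lra.
Qed.

End Conjugate.

(** * The gauge of the polar set as a support function *)

Section PolarGauge.
Context {R : realType} {n : nat} {V : set 'rV[R]_n}.
Context (V_compact : compact V) (V_0 : interior V 0).
Implicit Types x y v w e : 'rV[R]_n.
Local Notation N := (gauge (polar V)).

Let V0 : V 0 := interior_subset V_0.

(** For [t > 0], [x] lies in [t V^o] exactly when [<w, x> <= t] for all [w] in
    [V], so the gauge is the maximum of [<., x>] over the compact set [V]. *)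
Lemma gauge_polar_max x :
  exists v, [/\ V v, N x = dot v x & forall w, V w -> dot w x <= N x].
Proof.
have [v /set_mem Vv vmax] : exists2 v, v \in V & forall w, w \in V -> dot x w <= dot x v.
  apply: EVT_max_rV => //; first by exists 0.
  exact/continuous_subspaceT/dot_continuous.
have vx0 : 0 <= dot v x by rewrite -(dot0l x) !(dotC _ x) vmax // inE.
suff Nx : N x = dot v x.
  by exists v; split => // w Vw; rewrite Nx !(dotC _ x) vmax // inE.
have mem t : dot v x < t -> [set t | 0 <= t /\ exists2 c, polar V c & x = t *: c] t.
  move=> vt; have t0 : 0 < t := le_lt_trans vx0 vt.
  split; first exact: ltW.
  exists (t^-1 *: x) => [w Vw|]; last by rewrite scalerA mulfV ?scale1r // lt0r_neq0.
  rewrite dotZr ler_pdivrMl // mulr1 (le_trans _ (ltW vt)) //.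
  by rewrite !(dotC _ x) vmax // inE.
have lb : lbound [set t | 0 <= t /\ exists2 c, polar V c & x = t *: c] (dot v x).
  by move=> t [t0 [c Vc ->]]; rewrite dotZr ler_piMr // Vc.
apply/eqP; rewrite eq_le; apply/andP; split.
  apply/ler_addgt0Pr => e e0; apply: ge_inf; first by exists (dot v x).
  by apply: mem; rewrite ltrDl.
apply: lb_le_inf => //; exists (dot v x + 1); apply: mem; by rewrite ltrDl.
Qed.

Lemma gauge_polar_ub x w : V w -> dot w x <= N x.
Proof. by have [v [_ _]] := gauge_polar_max x; apply. Qed.

Lemma gauge_polar_le x (k : R) : (forall w, V w -> dot w x <= k) -> N x <= k.
Proof. by have [v [Vv -> _]] := gauge_polar_max x; apply. Qed.

Lemma gauge_polar_ge0 x : 0 <= N x.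
Proof. by rewrite -(dot0l x) gauge_polar_ub. Qed.

Lemma gauge_polarZ (s : R) x : 0 <= s -> N (s *: x) = s * N x.
Proof.
move=> s0; apply/eqP; rewrite eq_le; apply/andP; split.
  by apply: gauge_polar_le => w Vw; rewrite dotZr ler_wpM2l // gauge_polar_ub.
have [v [Vv -> _]] := gauge_polar_max x.
by rewrite -dotZr gauge_polar_ub.
Qed.

Lemma gauge_polar0 : N 0 = 0.
Proof. by rewrite -(scale0r 0) gauge_polarZ // mul0r. Qed.

Lemma gauge_polar_convex x y (t : R) : 0 <= t -> t <= 1 ->
  N (t *: x + (1 - t) *: y) <= t * N x + (1 - t) * N y.
Proof.
move=> t0 t1; apply: gauge_polar_le => w Vw; rewrite dotDr !dotZr.
by rewrite lerD // ler_wpM2l ?subr_ge0 // gauge_polar_ub.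
Qed.

Lemma gauge_polar_gt0 x : x != 0 -> 0 < N x.
Proof.
move=> x0; have /nbhs_ballP[r /= r0 Vr] := V_0.
have nx : 0 < `|x| by rewrite normr_gt0.
pose s := r / 2 / `|x|.
have s0 : 0 < s by rewrite !divr_gt0.
have Vs : V (s *: x).
  apply: Vr; rewrite -ball_normE /= sub0r normrN normrZ gtr0_norm //.
  by rewrite divfK ?lt0r_neq0 // ltr_pdivrMr // ltr_pMr // ltr1n.
apply: lt_le_trans (gauge_polar_ub x Vs).
by rewrite dotZl mulr_gt0 // dot_self_gt0.
Qed.

Lemma gauge_polar_lipschitz : exists2 C, 0 < C & forall x y, `|N x - N y| <= C * `|x - y|.
Proof.
have [M [_ hM]] := compact_bounded V_compact.
pose B := `|M| + 1; have B0 : 0 < B by rewrite ltr_wpDl.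
have VB w : V w -> `|w| <= B.
  by apply: hM; rewrite (le_lt_trans (ler_norm _)) // ltrDl.
exists (n%:R * B + 1) => [|x y]; first by rewrite ltr_wpDl // mulr_ge0 // ltW.
have half a b : N a - N b <= (n%:R * B + 1) * `|a - b|.
  rewrite lerBlDl; apply: gauge_polar_le => w Vw.
  rewrite -[a in dot w a](subrKC b) dotDr lerD ?gauge_polar_ub //.
  rewrite (le_trans (ler_norm _)) // (le_trans (dot_le_norm _ _)) // ler_wpM2r //.
  by rewrite (@le_trans _ _ (n%:R * B)) ?lerDl // ler_wpM2l // VB.
by rewrite ler_norml half andbT lerNl opprB distrC half.
Qed.

Lemma gauge_polar_continuous : continuous N.
Proof.
have [C C0 lip] := gauge_polar_lipschitz.
move=> x; apply/(@cvgrPdist_le _ R _ (nbhs x)) => e e0.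
have := @near_dist_le _ _ x (e / C) (divr_gt0 e0 C0).
by apply: filterS => z; rewrite ler_pdivlMr // mulrC; apply: le_trans.
Qed.

(** An interior point [v] could be moved in the direction [x], increasing [<v, x>]. *)
Lemma maximizer_boundary x v : x != 0 -> V v -> dot v x = N x -> boundary V v.
Proof.
move=> x0 Vv vx; split; first exact: subset_closure.
move=> /nbhs_ballP[r /= r0 Vr].
have nx : 0 < `|x| by rewrite normr_gt0.
pose s := r / 2 / `|x|.
have s0 : 0 < s by rewrite !divr_gt0.
have Vs : V (v + s *: x).
  apply: Vr; rewrite -ball_normE /= opprD addNKr normrN normrZ gtr0_norm //.
  by rewrite divfK ?lt0r_neq0 // ltr_pdivrMr // ltr_pMr // ltr1n.
have := gauge_polar_ub x Vs; rewrite leNgt dotDl vx dotZl ltrDl.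
by rewrite mulr_gt0 // dot_self_gt0.
Qed.

(** Two maximizers would be boundary points whose midpoint is both interior, by
    strict convexity of [V], and again a maximizer. *)
Lemma maximizer_unique x v w : strictly_convex V -> x != 0 ->
  V v -> V w -> dot v x = N x -> dot w x = N x -> v = w.
Proof.
move=> [_ _ strict] x0 Vv Vw vx wx; apply/eqP; apply: contrapT => /negP vw.
pose m := (1 / 2 : R) *: v + (1 - 1 / 2) *: w.
have Im : interior V m.
  apply: strict => //; [exact: maximizer_boundary vx|exact: maximizer_boundary wx|].
  by rewrite ltr_pdivrMr // mul1r ltr1n.
have mx : dot m x = N x by rewrite dotDl !dotZl vx wx; lra.
by have [_] := maximizer_boundary x0 (interior_subset Im) mx; apply.
Qed.

Definition indicator (A : set 'rV[R]_n) x : \bar R := if x \in A then 0%E else +oo%E.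

(** The gauge is the conjugate of the indicator of [V], and the corresponding
    tilted problem, the maximization of [<., x>] over [V], has the unique
    solution [v]. *)
Lemma gauge_polar_dirder x v e : strictly_convex V -> @convex_set R 'rV[R]_n V ->
  x != 0 -> V v -> dot v x = N x -> dirder N x e (dot v e).
Proof.
move=> V_strict V_convex x0 Vv vx.
have inV y : V y -> indicator V y = 0%E by rewrite /indicator => /mem_set ->.
have conjE : N = fine \o conjugate (indicator V).
  apply/funext => y /=; have [w [Vw Nw wy]] := gauge_polar_max y.
  rewrite Nw.
  rewrite (@conjugate_argmax _ _ _ _ w 0) ?inV // ?subr0 1?(dotC y) // => z.
  rewrite sub0r /tilt /indicator; case: ifPn => [/set_mem Vz|]; last by rewrite leey.
  by rewrite sub0e -EFinN lee_fin lerN2 (dotC y) -Nw wy.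
rewrite conjE; apply: (@conjugate_dirder _ _ _ _ _ 0); rewrite ?inV //.
- move=> y a; rewrite /indicator; case: ifPn => yV ay.
    exists setT; first exact: filterT.
    by move=> z _; case: ifPn => // _; rewrite ltry.
  exists (~` V).
    apply: open_nbhs_nbhs; split; last by move: yV; rewrite notin_setE.
    by apply: closed_openC; apply: compact_closed => //; exact: norm_hausdorff.
  by move=> z Vz; rewrite ifF ?ltry //; apply/negP => /set_mem.
- move=> y z t t0 t1; rewrite /indicator.
  have [yV|_] := boolP (y \in V); have [zV|_] := boolP (z \in V).
  + have ti := V_convex y z (Itv01 t0 t1) yV zV.
    by rewrite ifT // !mule0 adde0.
  + rewrite mule0 add0e; move: t1; rewrite le_eqVlt => /orP[/eqP ->|t1].
      by rewrite subrr scale0r scale1r addr0 yV mul0e.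
    by rewrite gt0_muley ?leey // lte_fin subr_gt0.
  + rewrite mule0 adde0; move: t0; rewrite le_eqVlt => /orP[/eqP <-|t0].
      by rewrite subr0 scale0r scale1r add0r zV mul0e.
    by rewrite gt0_muley ?leey // lte_fin.
  + have [->|t0'] := eqVneq t 0.
      by rewrite mul0e add0e subr0 mul1e leey.
    rewrite gt0_muley ?lte_fin ?lt_def ?t0' //.
    rewrite addye ?leey // -ltNye (@lt_le_trans _ _ 0%E) ?ltNy0 //.
    by rewrite mule_ge0 // lee_fin subr_ge0.
- move=> w wv; rewrite /tilt /indicator; case: ifPn => [/set_mem Vw|]; last by rewrite ltry.
  rewrite sub0r sub0e -EFinN lte_fin ltrN2 dotC (dotC x) vx lt_neqAle.
  rewrite gauge_polar_ub // andbT; apply: contra wv => /eqP wx.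
  by apply/eqP; apply: maximizer_unique wx vx.
Qed.

(** In case of equality, a maximizer [v] for the intermediate point also maximizes
    [<., x>] and [<., y>] over [V], so [x] and [y] are normals of supporting
    hyperplanes at [v].  Smoothness makes the hyperplanes equal, hence [x] and
    [y] proportional, and their equal gauges make them equal. *)
Lemma gauge_polar_strict x y (t : R) : smooth V -> N x = N y -> x != y ->
  0 < t -> t < 1 -> N (t *: x + (1 - t) *: y) < N x.
Proof.
move=> V_smooth Nxy xy t0 t1; pose z := t *: x + (1 - t) *: y.
have Nz := gauge_polar_convex x y (ltW t0) (ltW t1).
have Nzx : N z <= N x by rewrite (le_trans Nz) // -Nxy; lra.
rewrite lt_neqAle Nzx andbT; apply/eqP => Nzx'.
have [v [Vv vz _]] := gauge_polar_max z.
have [vx vy] : dot v x = N x /\ dot v y = N y.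
  have := gauge_polar_ub x Vv; have := gauge_polar_ub y Vv.
  move: vz; rewrite Nzx' dotDr !dotZr -Nxy => vz vy vx.
  have t1' : 0 < 1 - t by lra.
  have := ler_wpM2l (ltW t0) vx; have := ler_wpM2l (ltW t1') vy => h1 h2.
  split; apply/eqP; rewrite eq_le ?vx ?vy /=.
    by rewrite -(ler_pM2l t0); lra.
  by rewrite -(ler_pM2l t1'); lra.
have x_neq0 : x != 0.
  apply/eqP => x0; have y0 : y != 0 by rewrite -x0 eq_sym.
  by have := gauge_polar_gt0 y0; rewrite -Nxy x0 gauge_polar0 ltxx.
have Nx0 := gauge_polar_gt0 x_neq0.
have y_neq0 : y != 0 by apply/eqP => y0; move: Nx0; rewrite Nxy y0 gauge_polar0 ltxx.
have support p : p != 0 -> dot v p = N p ->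
    supporting_hyperplane V v [set u | dot p u = dot p v].
  by move=> p0 vp; exists p; split => // u Vu; rewrite !(dotC p) vp gauge_polar_ub.
have [H [_ uniqH]] := V_smooth v (maximizer_boundary x_neq0 Vv vx).
have Hxy : [set u | dot x u = dot x v] = [set u | dot y u = dot y v].
  by rewrite -(uniqH _ (support x x_neq0 vx)) -(uniqH _ (support y y_neq0 vy)).
have orth d : dot x d = 0 -> dot y d = 0.
  move=> xd; have : [set u | dot y u = dot y v] (v + d).
    by rewrite -Hxy /= dotDr xd addr0.
  by rewrite /= dotDr; lra.
(* The component of [y] orthogonal to [x] is orthogonal to [y] too, hence zero. *)
pose l := dot x y / dot x x.
have xx0 := dot_self_gt0 x_neq0.
have xd : dot x (y - l *: x) = 0.
  by rewrite dotBr dotZr divfK ?subrr // lt0r_neq0.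
have yl : y = l *: x.
  apply/eqP; rewrite -subr_eq0; apply: contrapT => /negP /dot_self_gt0.
  by rewrite {1}dotBl dotZl xd mulr0 orth // subr0 ltxx.
have : dot v y = l * dot v x by rewrite {1}yl dotZr.
rewrite vx vy -Nxy -{1}[N x]mul1r => /(mulIf (lt0r_neq0 Nx0)) l1.
by move: xy; rewrite yl -l1 scale1r eqxx.
Qed.

End PolarGauge.

(** * Legendre functions of one variable *)

Section LegendreOnTheLine.
Context {R : realType} {g : R -> \bar R}.
Context (g_ge0 : forall t, (0 <= g t)%E) (g_legendre : legendre g).
Context (g_0 : g 0 = 0%E) (g'_0 : has_derivative g 0 0).
Local Notation D := (edom g).
Local Notation G := (fine \o g).

Let gE t : D t -> g t = (G t)%:E.
Proof. by move=> Dt; rewrite /= fineK // ge0_fin_numE. Qed.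

Let G_ge0 t : 0 <= G t.
Proof. by rewrite fine_ge0. Qed.

Let G0 : G 0 = 0.
Proof. by rewrite /= g_0. Qed.

Let D0 : D 0.
Proof. by rewrite /edom /= g_0 ltry. Qed.

Lemma legendre_convex (a b t : R) : D a -> D b -> 0 <= t -> t <= 1 ->
  D (t * a + (1 - t) * b) /\ G (t * a + (1 - t) * b) <= t * G a + (1 - t) * G b.
Proof.
move=> Da Db t0 t1; have [[_ _ cg] _] := g_legendre.
have := cg a b t t0 t1; rewrite (gE Da) (gE Db) -!EFinM -EFinD => h.
have Dt : D (t * a + (1 - t) * b) := le_lt_trans h (ltry _).
by split => //; rewrite -lee_fin -gE.
Qed.

(** A convex function that is nonnegative and vanishes at 0 is at most
    [(a / b) * g b] at [a]. *)
Lemma legendre_mono (a b : R) : 0 <= a -> a <= b -> (g a <= g b)%E.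
Proof.
move=> a0 ab; have [b0|b0] := eqVneq b 0.
  by have -> : a = b; [apply/eqP; rewrite eq_le ab b0|].
have {b0} b0 : 0 < b by rewrite lt_def b0 (le_trans a0).
have [Db|] := boolP (g b < +oo)%E; last by rewrite -leNgt leye_eq => /eqP ->; rewrite leey.
have t0 : 0 <= a / b by rewrite divr_ge0 // ltW.
have t1 : a / b <= 1 by rewrite ler_pdivrMr // mul1r.
have [Da h] := legendre_convex Db D0 t0 t1.
move: Da h; rewrite mulr0 addr0 divfK ?lt0r_neq0 // G0 mulr0 addr0 => Da h.
rewrite (gE Da) (gE Db) lee_fin (le_trans h) // ler_piMl //.
Qed.

(** The domain is an interval that extends to the left of 0. *)
Lemma legendre_dom_interior (a b : R) : D b -> 0 <= a -> a < b -> interior D a.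
Proof.
move=> Db a0 ab; have [/nbhs_ballP[r /= r0 Dr] _] := g'_0.
have Dr2 : D (- (r / 2)).
  apply: Dr; rewrite -ball_normE /= sub0r opprK gtr0_norm ?divr_gt0 //.
  by rewrite ltr_pdivrMr // ltr_pMr // ltr1n.
have [c c0 cr] : exists2 c : R, 0 < c & c <= r / 2 /\ c <= b - a.
  exists (Num.min (r / 2) (b - a)); first by rewrite lt_min divr_gt0 // subr_gt0.
  by rewrite !ge_min !lexx orbT.
apply/nbhs_ballP; exists c => //= z; rewrite -ball_normE /= ltr_norml => /andP[z1 z2].
case: cr => cr cba; pose w := b + r / 2.
have w0 : 0 < w by rewrite /w; lra.
(* [z] lies between [b] and [- r / 2], a point of the domain left of 0. *)
pose t := (z + r / 2) / w.
have [|//|h _] := @legendre_convex b (- (r / 2)) t Db Dr2.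
- by rewrite divr_ge0 // ?ltW //; lra.
- by rewrite ler_pdivrMr // mul1r /w; lra.
suff -> : z = t * b + (1 - t) * - (r / 2) by [].
by rewrite /t /w; field; apply: lt0r_neq0; lra.
Qed.

(** The strict convexity in [legendre] concerns interior points only.  Since
    [z = t a + (1 - t) b] is the same combination of the midpoints [a'] of [a, z]
    and [b'] of [b, z], which are interior, strictness passes to the end points. *)
Lemma legendre_strict (a b t : R) : D a -> D b -> 0 <= a -> 0 <= b -> a != b ->
  0 < t -> t < 1 -> G (t * a + (1 - t) * b) < t * G a + (1 - t) * G b.
Proof.
move=> Da Db a0 b0 ab t0 t1.
have [_ [_ _ _ strict]] := g_legendre.
have t1' : 0 < 1 - t by rewrite subr_gt0.
pose z := t * a + (1 - t) * b; pose m := Num.max a b.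
have Dm : D m by rewrite /m /Num.max; case: ifP.
have am : a <= m by rewrite le_max lexx.
have bm : b <= m by rewrite le_max lexx orbT.
have zm : z < m.
  have : a < m \/ b < m.
    by rewrite !lt_max !ltxx /= orbF; case: ltgtP ab => //; auto.
  have := ler_wpM2l (ltW t0) am; have := ler_wpM2l (ltW t1') bm.
  move=> ma mb; rewrite /z; case=> h; have := h.
    by rewrite -(ltr_pM2l t0); lra.
  by rewrite -(ltr_pM2l t1'); lra.
have z0 : 0 <= z by rewrite addr_ge0 // mulr_ge0 // ltW.
have [Dz Gz] := legendre_convex Da Db (ltW t0) (ltW t1).
have h0 : (0 : R) <= 1 / 2 by lra.
have h1 : (1 / 2 : R) <= 1 by lra.
have [Da' Ga'] := legendre_convex Da Dz h0 h1.
have [Db' Gb'] := legendre_convex Db Dz h0 h1.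
rewrite -/z in Dz Gz Da' Ga' Db' Gb' *.
set a' := 1 / 2 * a + _ in Da' Ga'; set b' := 1 / 2 * b + _ in Db' Gb'.
have Ia : interior D a' by apply: legendre_dom_interior Dm _ _; rewrite /a'; lra.
have Ib : interior D b' by apply: legendre_dom_interior Dm _ _; rewrite /b'; lra.
have a'b' : a' != b'.
  by apply: contra ab => /eqP; rewrite /a' /b' => ?; apply/eqP; lra.
have := strict a' b' t Ia Ib a'b' t0 t1.
rewrite -[t *: a' + _ *: b']/(t * a' + (1 - t) * b').
have -> : t * a' + (1 - t) * b' = z by rewrite /a' /b' /z; lra.
rewrite (gE Dz) (gE Da') (gE Db') -!EFinM -EFinD lte_fin => Gz'.
have := ler_wpM2l (ltW t0) Ga'; have := ler_wpM2l (ltW t1') Gb'; lra.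
Qed.

Lemma legendre_mono_strict (a b : R) : 0 <= a -> a < b -> D b -> G a < G b.
Proof.
move=> a0 ab Db; have b0 : 0 < b by rewrite (le_lt_trans a0).
have below (c : R) : 0 < c -> c < b -> G c < c / b * G b.
  move=> c0 cb; have := @legendre_strict b 0 (c / b) Db D0 (ltW b0) (lexx 0).
  rewrite lt0r_neq0 // divr_gt0 // ltr_pdivrMr // mul1r cb => /(_ isT isT isT).
  by rewrite mulr0 addr0 divfK ?lt0r_neq0 // G0 mulr0 addr0.
have half : 0 < G b.
  have := below (b / 2); rewrite divr_gt0 // ltr_pdivrMr // ltr_pMr // ltr1n.
  move=> /(_ isT isT); have := G_ge0 (b / 2).
  have -> : b / 2 / b = 1 / 2 by field; rewrite lt0r_neq0.
  move: (G b) (G (b / 2)) => ? ?; lra.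
move: a0; rewrite le_eqVlt => /orP[/eqP <-|a0]; first by rewrite G0.
by rewrite (lt_trans (below a a0 ab)) // gtr_pMl // ltr_pdivrMr // mul1r.
Qed.

Lemma legendre_dirder (r : R) : interior D r -> exists d, dirder G r 1 d.
Proof.
move=> Dr; have [_ [_ /(_ r Dr) /derivableP dG _ _]] := g_legendre.
by exists ('D_1 G r); apply/is_derive_dirder.
Qed.

(** At a boundary point of the domain the slopes of [g] on the left are unbounded,
    but by convexity they are at most [K / r] under the hypothesis, which is what
    optimality along the ray through a minimizer provides. *)
Lemma legendre_steep (r K : R) : 0 <= r -> D r ->
  (forall s : R, 0 < s -> s < 1 -> G r - G (s * r) <= (1 - s) * K) -> interior D r.
Proof.
move=> r_ge0 Dr GK; apply: contrapT => nDr.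
have r0 : 0 < r.
  rewrite lt_def r_ge0 andbT; apply/eqP => r0; apply: nDr; rewrite r0.
  by case: g'_0.
have slope_le (s : R) : 0 < s -> s < 1 -> `|derive1 G (s * r)| <= K / r.
  move=> s0 s1; have sr0 : 0 < s * r by rewrite mulr_gt0.
  have srr : s * r < r by rewrite gtr_pMl.
  have Dsr := legendre_dom_interior Dr (ltW sr0) srr.
  have [d dG] := legendre_dirder Dsr.
  rewrite derive1E; have [_ ->] : is_derive (s * r) 1 G d by apply/is_derive_dirder.
  have lt0 : 0 < r - s * r by rewrite subr_gt0.
  rewrite ger0_norm; last first.
    apply: (dirder_ge lt0 dG) => t t0 tr; rewrite mulr0 subr_ge0.
    have Dt : D (t + s * r).
      by apply: interior_subset; apply: legendre_dom_interior Dr _ _; lra.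
    rewrite [_%:A]mulr1 -lee_fin -(gE Dt) -(gE (interior_subset Dsr)).
    by apply: legendre_mono; lra.
  apply: (dirder_le lt0 dG) => t t0 tr; rewrite [_%:A]mulr1.
  have l0 : 0 <= t / (r - s * r) by rewrite divr_ge0 // ltW.
  have l1 : t / (r - s * r) <= 1 by rewrite ler_pdivrMr // mul1r ltW.
  have [_] := legendre_convex Dr (interior_subset Dsr) l0 l1.
  have -> : t / (r - s * r) * r + (1 - t / (r - s * r)) * (s * r) = t + s * r.
    by field; rewrite lt0r_neq0.
  have := ler_wpM2l l0 (GK s s0 s1).
  have -> : t / (r - s * r) * ((1 - s) * K) = t * (K / r).
    by field; rewrite !lt0r_neq0.
  move: (G r) (G (s * r)) (G (t + s * r)) (t / (r - s * r)) => ? ? ? ?; lra.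
have [_ [_ _ steep _]] := g_legendre.
(* Factors in ]0, 1[ tending to 1: [s k * r] is interior and tends to [r]. *)
pose s (k : nat) : R := 1 - harmonic k / 2.
have s01 k : 0 < s k < 1.
  have h0 : (0 : R) < harmonic k by rewrite harmonic_gt0.
  have h1 : harmonic k <= 1 :> R by rewrite invf_le1 ?ler1n // ltr0n.
  by rewrite /s; lra.
have /steep : forall k, interior D (s k * r).
  move=> k; have /andP[? ?] := s01 k; apply: legendre_dom_interior Dr _ _.
    by rewrite mulr_ge0 // ltW.
  by rewrite gtr_pMl.
have sr : s k * r @[k --> \oo] --> r.
  have h1 : s k @[k --> \oo] --> (1 - 0 * 2^-1 : R).
    apply: cvgB; first exact: cvg_cst.
    by apply: cvgMl; exact: cvg_harmonic.
  by rewrite -[X in _ --> X]mul1r -[X in X * r](subr0 1) -(mul0r 2^-1); apply: cvgMl.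
have bdr : boundary D r by split => //; exact: subset_closure.
move=> /(_ r sr bdr) /cvgryPgt /(_ (K / r)) [N _ /(_ N (leqnn N))] /=.
by have /andP[? ?] := s01 N; rewrite ltNge slope_le.
Qed.

End LegendreOnTheLine.

(** * Tilted problems over a convex set, and the three paths *)

Section StrictlyConvexPrograms.
Context {R : realType} {n : nat}.
Implicit Types (x y z u v e : 'rV[R]_n) (X : set 'rV[R]_n) (psi : 'rV[R]_n -> \bar R).

Lemma tilt0 psi : tilt psi 0 = psi.
Proof. by apply/funext => x; rewrite /tilt dot0l sube0. Qed.

Lemma argmin_tilt_dom psi X u x : (exists2 z, X z & (psi z < +oo)%E) ->
  argmin X (tilt psi u) x -> (psi x < +oo)%E.
Proof.
move=> [z Xz psiz] [_ /(_ z Xz)]; rewrite /tilt.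
by case: (psi x) => [p| |]; rewrite ?ltry ?ltNyr //; case: (psi z) psiz.
Qed.

(** The midpoint of two minimizers would do strictly better. *)
Lemma argmin_tilt_unique psi X u x y :
  @convex_set R 'rV[R]_n X -> (forall z, (0 <= psi z)%E) ->
  strictly_econvex_on (edom psi) psi -> (exists2 z, X z & (psi z < +oo)%E) ->
  argmin X (tilt psi u) x -> argmin X (tilt psi u) y -> x = y.
Proof.
move=> cX psi_ge0 strict dom ax ay; apply/eqP; apply: contrapT => /negP xy.
have psix := argmin_tilt_dom dom ax; have psiy := argmin_tilt_dom dom ay.
have h0 : (0 : R) < 1 / 2 by lra.
have h1 : (1 / 2 : R) < 1 by lra.
have := strict x y (1 / 2) psix psiy xy h0 h1.
case: ax ay => [Xx minx] [Xy miny].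
pose m := (1 / 2 : R) *: x + (1 - 1 / 2) *: y.
have Xm : X m.
  have := cX x y (Itv01 (ltW h0) (ltW h1)); rewrite !inE; exact.
rewrite -/m; have := minx m Xm; have := miny m Xm.
have := psi_ge0 x; have := psi_ge0 y; rewrite /tilt {2 4}/m !dotDr !dotZr.
case: (psi x) psix => [p| |] //= _; case: (psi y) psiy => [q| |] //= _.
case: (psi m) => [r| |] //= _ _; rewrite -?EFinN -?EFinM -?EFinD ?lee_fin ?lte_fin; lra.
Qed.

Lemma argmin_tilt_strict psi X u x (c : R) :
  @convex_set R 'rV[R]_n X -> (forall z, (0 <= psi z)%E) ->
  strictly_econvex_on (edom psi) psi -> psi x = c%:E ->
  argmin X (tilt psi u) x ->
  forall z, X z -> z != x -> ((c - dot u x)%:E < tilt psi u z)%E.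
Proof.
move=> cX psi_ge0 strict psix ax z Xz zx.
have tx : tilt psi u x = (c - dot u x)%:E by rewrite /tilt psix.
have [Xx minx] := ax; rewrite -tx ltNge; apply/negP => zlex.
have az : argmin X (tilt psi u) z.
  by split => // y Xy; apply: le_trans zlex (minx y Xy).
have dom : exists2 z, X z & (psi z < +oo)%E by exists x; rewrite ?psix ?ltry.
by rewrite (argmin_tilt_unique cX psi_ge0 strict dom az ax) eqxx in zx.
Qed.

(** Away from [x0] the growth of [psi] beats the gain [<u, x - x0>], which is at
    most half of it. *)
Lemma argmin_tilt_near psi X u x0 x (c d rho : R) :
  psi x0 = c%:E -> X x0 -> 0 < d -> 0 < rho ->
  (forall z, X z -> rho <= `|z - x0| -> ((c + d * `|z - x0|)%:E <= psi z)%E) ->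
  (forall z, `|dot u z| <= d / 2 * `|z|) ->
  argmin X (tilt psi u) x -> `|x - x0| < rho.
Proof.
move=> psix0 Xx0 d0 rho0 growth small [Xx minx]; rewrite ltNge; apply/negP => far.
have := minx x0 Xx0; have := growth x Xx far; rewrite /tilt psix0.
have := small (x - x0); rewrite dotBr ler_norml => /andP[_].
have : 0 < d * `|x - x0| by rewrite mulr_gt0 // (lt_le_trans rho0).
case: (psi x) => [p| |] //=.
rewrite -?EFinN -?EFinD ?lee_fin; lra.
Qed.

(** The growth of [psi] leaves half of its rate to the tilted function, which is
    therefore coercive. *)
Lemma argmin_tilt_nonempty psi X u x0 (c d : R) :
  closed X -> lower_semicontinuous psi -> psi x0 = c%:E -> X x0 -> 0 < d ->
  (forall z, X z -> (c%:E <= psi z)%E) ->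
  (forall z, X z -> 1 <= `|z - x0| -> ((c + d * `|z - x0|)%:E <= psi z)%E) ->
  (forall z, `|dot u z| <= d / 2 * `|z|) ->
  argmin X (tilt psi u) !=set0.
Proof.
move=> cX lpsi psix0 Xx0 d0 minx0 growth small.
apply: (@lsc_argmin _ _ _ _ (d / 2) (d * `|x0| + d - c)) => //.
- exact: lsc_tilt.
- by rewrite divr_gt0.
- move=> z Xz.
  have tri : d * `|z| <= d * `|z - x0| + d * `|x0|.
    by rewrite -mulrDr ler_pM2l // -{1}[z](subrK x0) ler_normD.
  have := small z; rewrite ler_norml => /andP[_ uz].
  have : ((c + d * `|z - x0| - d)%:E <= psi z)%E.
    have [far|near] := leP 1 `|z - x0|.
      by apply: le_trans (growth z Xz far); rewrite lee_fin; lra.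
    apply: le_trans (minx0 z Xz); rewrite lee_fin.
    have : d * `|z - x0| <= d * 1 by rewrite ler_pM2l // ltW.
    lra.
  rewrite /tilt; case: (psi z) => [p| |] //=; last by rewrite !leey.
  rewrite -?EFinN -?EFinD ?lee_fin; lra.
- by exists x0 => //; rewrite /tilt psix0 -EFinB ltry.
Qed.

(** As [w] tends to infinity the linear perturbation becomes smaller than any
    growth rate of [psi] at its minimizer: [argmin_tilt_nonempty] with radius 1
    gives existence, [argmin_tilt_near] with arbitrary radius gives convergence. *)
Lemma argmin_tilt_path_limit psi X a x0 (c : R) :
  closed X -> @convex_set R 'rV[R]_n X -> lower_semicontinuous psi -> econvex psi ->
  (forall z, (0 <= psi z)%E) -> strictly_econvex_on (edom psi) psi ->
  psi x0 = c%:E -> argmin X psi x0 ->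
  path_limit +oo (fun w => argmin X (tilt psi (- (w^-1 *: a)))) x0.
Proof.
move=> cX convX lpsi cpsi psi_ge0 strict psix0 min0; have [Xx0 minx0] := min0.
have dom : exists2 z, X z & (psi z < +oo)%E by exists x0; rewrite ?psix0 ?ltry.
have strict0 z : X z -> z != x0 -> (c%:E < psi z)%E.
  have := @argmin_tilt_strict psi X 0 x0 c convX psi_ge0 strict psix0.
  by rewrite tilt0 dot0l subr0; apply.
have growth := strict_min_growth cX convX lpsi cpsi Xx0 psix0 strict0.
have [C C0 hC] := dot_bounded a.
have small (d : R) : 0 < d -> \forall w \near +oo,
    forall z, `|dot (- (w^-1 *: a)) z| <= d / 2 * `|z|.
  move=> d0; near=> w => z.
  have w0 : 0 < w by near: w; exact: nbhs_pinfty_gt.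
  have Cw : 2 * C / d <= w by near: w; apply: nbhs_pinfty_ge; exact: num_real.
  have wC : w^-1 * C <= d / 2.
    by move: Cw; rewrite (mulrC w^-1) !ler_pdivrMr //; lra.
  rewrite dotNl dotZl normrN normrM gtr0_norm ?invr_gt0 //.
  have := ler_wpM2r (normr_ge0 z) wC; apply: le_trans.
  by rewrite -mulrA ler_wpM2l // invr_ge0 ltW.
pose P w := argmin X (tilt psi (- (w^-1 *: a))).
exists (fun w => xget x0 (P w)); split.
  have [d d0 hd] := growth 1 ltr01.
  apply: filterS (small d d0) => w uw.
  have [x Px] := argmin_tilt_nonempty cX lpsi psix0 Xx0 d0
    (fun z Xz => eq_rect _ (fun r => (r <= psi z)%E) (minx0 z Xz) _ psix0) hd uw.
  have Pxget := xgetI x0 Px.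
  apply/seteqP; split=> [y Py|y ->//].
  exact: (argmin_tilt_unique convX psi_ge0 strict dom Py Pxget).
apply/cvgrPdist_le => rho rho0.
have [d d0 hd] := growth rho rho0.
have [d1 d10 hd1] := growth 1 ltr01.
apply: filterS2 (small d d0) (small d1 d10) => w uw uw1.
have [x Px] := argmin_tilt_nonempty cX lpsi psix0 Xx0 d10
  (fun z Xz => eq_rect _ (fun r => (r <= psi z)%E) (minx0 z Xz) _ psix0) hd1 uw1.
rewrite distrC ltW //.
exact: argmin_tilt_near psix0 Xx0 d0 rho0 hd uw (xgetI x0 Px).
Unshelve. all: by end_near. Qed.

Lemma argmin_affine X (f : 'rV[R]_n -> \bar R) (w k : R) : 0 < w ->
  argmin X (fun x => w%:E * f x + k%:E)%E = argmin X f.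
Proof.
move=> w0; apply/seteqP; split=> x [Xx minx]; split => // z Xz; have := minx z Xz.
  by rewrite leeD2rE // lee_pmul2l // lte_fin.
by rewrite leeD2rE // lee_pmul2l // lte_fin.
Qed.

Lemma bregman_proj_tilt psi X y : (forall z, (0 <= psi z)%E) -> interior (edom psi) y ->
  bregman_proj psi X y = argmin X (tilt psi (gradient psi y)).
Proof.
move=> psi_ge0 Iy; have [q psiy] : exists q, psi y = q%:E.
  by have := interior_subset Iy; have := psi_ge0 y; rewrite /edom /=;
    case: (psi y) => [q| |] // _ _; exists q.
rewrite -(@argmin_affine _ _ 1 (dot (gradient psi y) y - q) ltr01).
have -> : (fun x => 1 * tilt psi (gradient psi y) x + (dot (gradient psi y) y - q)%:E)%E
    = bregman psi ^~ y.
  apply/funext => z; rewrite mul1e /tilt /bregman psiy dotBr.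
  case: (psi z) => [p| |] //=; rewrite -?EFinN -?EFinD; congr (_%:E); ring.
by apply/seteqP; split => x //= [].
Qed.

Lemma central_path_tilt psi X a x0 (w c : R) : 0 < w -> psi x0 = c%:E ->
  central_path X a psi x0 w = argmin X (tilt psi (gradient psi x0 - w^-1 *: a)).
Proof.
move=> w0 psix0.
rewrite -(@argmin_affine _ _ w (w * (dot (gradient psi x0) x0 - c)) w0).
congr (argmin X _); apply/funext => z; rewrite /tilt /bregman psix0 dotBr dotBl dotZl.
case: (psi z) => [p| |] /=; last 2 first.
- by rewrite gt0_muley ?lte_fin.
- by rewrite gt0_muleNy ?lte_fin.
rewrite -?EFinN -?EFinD -?EFinM -?EFinD; congr (_%:E).
by field; rewrite lt0r_neq0.
Qed.

Lemma robust_path_tilt psi X a (w : R) : 0 < w ->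
  robust_path X a psi w = argmin X (tilt psi (- (w^-1 *: a))).
Proof.
move=> w0; rewrite -(@argmin_affine _ _ w 0 w0).
congr (argmin X _); apply/funext => z; rewrite /tilt dotNl dotZl.
case: (psi z) => [p| |] /=; last 2 first.
- by rewrite gt0_muley ?lte_fin.
- by rewrite gt0_muleNy ?lte_fin.
rewrite -?EFinN -?EFinD -?EFinM -?EFinD; congr (_%:E).
by field; rewrite lt0r_neq0.
Qed.

Lemma path_points_ext (P Q : R -> set 'rV[R]_n) :
  (forall w, 0 < w -> P w = Q w) -> path_points P = path_points Q.
Proof.
have sub (P' Q' : R -> set 'rV[R]_n) : (forall w, 0 < w -> P' w = Q' w) ->
    path_points P' `<=` path_points Q'.
  move=> PQ x [[w w0 Pw]|[s [Ps sx]]]; [left|right].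
    by exists w; rewrite -?PQ.
  exists s; split => //; apply: filterS2 Ps (nbhs_right_gt 0) => w Pw w0.
  by rewrite -PQ.
by move=> PQ; apply/seteqP; split; apply: sub => // w /PQ.
Qed.

End StrictlyConvexPrograms.

(** * The composition of a Legendre function with the gauge *)

Section LegendreOfPolarGauge.
Context {R : realType} {n : nat} {V : set 'rV[R]_n} {g : R -> \bar R}.
Context (V_convex : @convex_set R 'rV[R]_n V) (V_compact : compact V)
  (V_smooth : smooth V) (V_strict : strictly_convex V) (V_0 : interior V 0).
Context (g_ge0 : forall t, (0 <= g t)%E) (g_legendre : legendre g)
  (g_0 : g 0 = 0%E) (g'_0 : has_derivative g 0 0).
Implicit Types x y z u e : 'rV[R]_n.
Local Notation N := (gauge (polar V)).
Local Notation phi := (g \o gauge (polar V)).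
Local Notation D := (edom g).

Let N_ge0 x : 0 <= N x := gauge_polar_ge0 V_compact V_0 x.

Lemma legendre_gauge_lsc : lower_semicontinuous phi.
Proof.
move=> x a /= ax; have [[_ lg _] _] := g_legendre.
have [W NW Wa] := lg _ _ ax.
exists (N @^-1` W) => [|y /Wa //].
exact: (gauge_polar_continuous V_compact V_0).
Qed.

Lemma legendre_gauge_convex : econvex phi.
Proof.
move=> x y t t0 t1 /=; have [[_ _ cg] _] := g_legendre.
apply: le_trans (cg (N x) (N y) t t0 t1).
apply: (legendre_mono g_ge0 g_legendre g_0) => //.
exact: gauge_polar_convex.
Qed.

(** Points of different gauge are separated by the strict convexity of [g]; between
    points of equal gauge the gauge itself drops and [g] is strictly increasing. *)
Lemma legendre_gauge_strictly_convex : strictly_econvex_on (edom phi) phi.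
Proof.
move=> x y t Dx Dy xy t0 t1; rewrite /=.
have gE r : D r -> g r = (fine (g r))%:E by move=> Dr; rewrite fineK // ge0_fin_numE.
have [Dz hz] := legendre_convex g_ge0 g_legendre Dx Dy (ltW t0) (ltW t1).
have Nz := gauge_polar_convex V_compact V_0 x y (ltW t0) (ltW t1).
have gNz := legendre_mono g_ge0 g_legendre g_0 (N_ge0 (t *: x + (1 - t) *: y)) Nz.
rewrite [g (N x)]gE // [g (N y)]gE // -!EFinM -EFinD.
have [Nxy|Nxy] := eqVneq (N x) (N y).
  have := gauge_polar_strict V_compact V_0 V_smooth Nxy xy t0 t1.
  move=> /(legendre_mono_strict g_ge0 g_legendre g_0 g'_0 (N_ge0 _)) /(_ Dx) /= h.
  rewrite gE; last exact: le_lt_trans gNz Dz.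
  by rewrite lte_fin -Nxy; lra.
apply: le_lt_trans gNz _; rewrite gE // lte_fin.
exact: (legendre_strict g_ge0 g_legendre g'_0).
Qed.

Lemma legendre_gauge_interior x : interior D (N x) -> interior (edom phi) x.
Proof.
exact: (@gauge_polar_continuous _ _ _ V_compact V_0 x D).
Qed.

(** At the origin the gauge need not be differentiable, but [g] has slope 0 there. *)
Lemma legendre_gauge_dirder x : interior D (N x) ->
  exists p, forall e, dirder (fine \o phi) x e (dot p e).
Proof.
move=> DNx; have [d dG] := legendre_dirder g_legendre DNx.
have [C C0 lip] := gauge_polar_lipschitz V_compact V_0.
have lipN e t : `|N (t *: e + x) - N x| <= C * `|e| * `|t|.
  by apply: le_trans (lip _ _) _; rewrite addrK normrZ (mulrC `|t|) mulrA.
have [x0|x0] := eqVneq x 0.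
  have d0 : d = 0.
    move: dG; rewrite x0 gauge_polar0 // => /is_derive_dirder [_ <-].
    by have [_ [_ ->]] := g'_0.
  exists 0 => e; rewrite dot0l -(mul0r 0) -{1}d0.
  by apply: (dirder_comp dG (lipN e)); left.
have [v [Vv Nx _]] := gauge_polar_max V_compact V_0 x.
exists (d *: v) => e; rewrite dotZl; apply: (dirder_comp dG (lipN e)); right.
exact: gauge_polar_dirder.
Qed.

(** Comparing the minimizer [x] with [s x] for [s < 1] bounds the slopes of [g]
    below [gauge x], which steepness forbids at the end of the domain. *)
Lemma argmin_legendre_gauge_interior u x : argmin setT (tilt phi u) x -> interior D (N x).
Proof.
move=> ax; have Dx : D (N x).
  by apply: argmin_tilt_dom ax; exists 0; rewrite //= gauge_polar0 // g_0 ltry.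
have gE r : D r -> g r = (fine (g r))%:E by move=> Dr; rewrite fineK // ge0_fin_numE.
apply: (@legendre_steep _ _ g_ge0 g_legendre g_0 g'_0 _ (dot u x)) => // s s0 s1.
have Ds : D (s * N x).
  apply: le_lt_trans Dx; apply: (legendre_mono g_ge0 g_legendre g_0).
    by rewrite mulr_ge0 // ltW.
  by rewrite ler_piMl // ltW.
have [_ /(_ (s *: x) I)] := ax; rewrite /tilt dotZr /= gauge_polarZ ?(ltW s0) //.
by rewrite [g (N x)]gE // [g (s * N x)]gE // -!EFinB lee_fin; lra.
Qed.

(** First-order condition: in each direction [e] the derivative is at least
    [<u, e>], and [- e] gives the reverse inequality. *)
Lemma gradient_argmin_legendre_gauge u x : argmin setT (tilt phi u) x -> gradient phi x = u.
Proof.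
move=> ax; have DNx := argmin_legendre_gauge_interior ax.
have [p dphi] := legendre_gauge_dirder DNx.
have /nbhs_ballP[r /= r0 xr] := legendre_gauge_interior DNx.
have gE y : edom phi y -> phi y = (fine (phi y))%:E.
  by move=> Dr; rewrite fineK // ge0_fin_numE //=.
have ge e : dot u e <= dot p e.
  have re0 : 0 < r / (`|e| + 1) by rewrite divr_gt0 // ltr_wpDl.
  apply: (dirder_ge re0 (dphi e)) => t t0 tr.
  have Dte : edom phi (t *: e + x).
    apply: xr; rewrite -ball_normE /= opprD addrCA subrr addr0 normrN normrZ gtr0_norm //.
    move: tr; rewrite ltr_pdivlMr ?ltr_wpDl //; lra.
  have [_ /(_ (t *: e + x) I)] := ax; rewrite /tilt dotDr dotZr.
  rewrite (gE _ Dte) (gE _ (xr _ (ballxx _ r0))) -!EFinB lee_fin /=; lra.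
apply: gradientP => e; rewrite (_ : dot u e = dot p e) //.
by apply/eqP; rewrite eq_le ge /= -lerN2 -!dotNr ge.
Qed.

(** The origin minimizes [phi], that is, the tilt by [u = 0]. *)
Lemma gradient_legendre_gauge0 : gradient phi 0 = 0.
Proof.
apply: gradient_argmin_legendre_gauge; split => // z _; rewrite tilt0 /= gauge_polar0 // g_0.
exact: g_ge0.
Qed.

Lemma gradient_legendre_gaugeK u : interior (edom (conjugate phi)) u ->
  interior (edom phi) (gradient (conjugate phi) u) /\
  gradient phi (gradient (conjugate phi) u) = u.
Proof.
move=> /tilt_coercive [eta eta0 [C coer]].
have dom : exists2 x, [set: 'rV[R]_n] x & (phi x < +oo)%E.
  by exists 0; rewrite //= gauge_polar0 // g_0 ltry.
have [x ax] : argmin setT (tilt phi u) !=set0.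
  apply: (@lsc_argmin _ _ _ _ eta C closedT (lsc_tilt legendre_gauge_lsc) eta0).
    by move=> z _.
  by exists 0; rewrite // /tilt /= gauge_polar0 // g_0 dot0r sube0 ltry.
have DNx := argmin_legendre_gauge_interior ax.
have phix : phi x = (fine (phi x))%:E.
  by rewrite fineK // ge0_fin_numE //=; exact: (interior_subset DNx).
have convT : @convex_set R 'rV[R]_n setT by move=> ? ? ? _ _; rewrite inE.
have strict z : z != x -> ((fine (phi x) - dot u x)%:E < tilt phi u z)%E.
  apply: (argmin_tilt_strict convT _ legendre_gauge_strictly_convex phix ax) => // y.
  exact: g_ge0.
rewrite (gradientP (conjugate_dirder legendre_gauge_lsc legendre_gauge_convex phix strict)).
by split; [exact: legendre_gauge_interior | exact: gradient_argmin_legendre_gauge].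
Qed.

End LegendreOfPolarGauge.

Theorem theorem1 (R : realType) (n : nat)
  (X : set 'rV[R]_n) (a0 : 'rV[R]_n) (V : set 'rV[R]_n)
  (g : R -> \bar R) (phi : 'rV[R]_n -> \bar R)
  (xR : 'rV[R]_n)
  (X_nonempty : X !=set0) (X_closed : closed X) (X_convex : @convex_set R 'rV[R]_n X)
  (V_convex : @convex_set R 'rV[R]_n V) (V_compact : compact V)
  (V_smooth : smooth V) (V_strictly_convex : strictly_convex V) (V_0 : interior V 0)
  (g_ge0 : forall t, (0 <= g t)%E) (g_legendre : legendre g)
  (g_0 : g 0 = 0%E) (g'_0 : has_derivative g 0 0)
  (phiE : phi = g \o gauge (polar V))
  (X_dom : (X `&` interior (edom phi)) !=set0)
  (xR_argmin : argmin X phi xR) :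
  [/\ path_limit +oo (robust_path X a0 phi) xR,
      (forall w, 0 < w ->
         interior (edom (conjugate phi)) (gradient phi 0 - w^-1 *: a0)) ->
      path_points (robust_path X a0 phi) =
      path_points (fun w => bregman_proj phi X
        (gradient (conjugate phi) (gradient phi 0 - w^-1 *: a0))),
      (forall w, 0 < w ->
         interior (edom (conjugate phi)) (gradient phi xR - w^-1 *: a0)) ->
      path_points (central_path X a0 phi xR) =
      path_points (fun w => bregman_proj phi X
        (gradient (conjugate phi) (gradient phi xR - w^-1 *: a0))) &
      forall (lam : R^nat) (x : nat -> 'rV[R]_n),
        (forall k, 0 < lam k) ->
        (\sum_(0 <= k <oo) ((lam k)^-1)%:E = +oo)%E ->
        proximal_path X a0 phi lam xR x ->
        forall k,
          interior (edom (conjugate phi)) (gradient phi (x k) - (lam k)^-1 *: a0) ->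
          bregman_proj phi X
            (gradient (conjugate phi) (gradient phi (x k) - (lam k)^-1 *: a0))
          = [set x k.+1]].
Proof.
have phi_ge0 z : (0 <= phi z)%E by rewrite phiE; exact: g_ge0.
have lsc : lower_semicontinuous phi by rewrite phiE; exact: legendre_gauge_lsc.
have convex : econvex phi by rewrite phiE; exact: legendre_gauge_convex.
have strict : strictly_econvex_on (edom phi) phi by rewrite phiE; exact: legendre_gauge_strictly_convex.
have grad0 : gradient phi 0 = 0 by rewrite phiE; exact: gradient_legendre_gauge0.
have proj_tilt u : interior (edom (conjugate phi)) u ->
    bregman_proj phi X (gradient (conjugate phi) u) = argmin X (tilt phi u).
  move=> Iu; have [Iy gy] : interior (edom phi) (gradient (conjugate phi) u) /\
      gradient phi (gradient (conjugate phi) u) = u.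
    by move: Iu; rewrite phiE; exact: gradient_legendre_gaugeK.
  by rewrite bregman_proj_tilt // gy.
have phiK z : (phi z < +oo)%E -> phi z = (fine (phi z))%:E.
  by move=> phiz; rewrite fineK // ge0_fin_numE.
have dom : exists2 z, X z & (phi z < +oo)%E.
  by have [z [Xz /interior_subset phiz]] := X_dom; exists z.
have phixR : (phi xR < +oo)%E.
  by apply: (@argmin_tilt_dom _ _ phi X 0); rewrite ?tilt0.
split.
- have [s [Ps sx]] := argmin_tilt_path_limit a0 X_closed X_convex lsc convex phi_ge0
    strict (phiK _ phixR) xR_argmin.
  exists s; split => //; apply: filterS2 Ps (nbhs_pinfty_gt (num_real 0)) => w Pw w0.
  by rewrite -Pw robust_path_tilt.
- move=> Iw; apply: path_points_ext => w w0.
  by rewrite (proj_tilt _ (Iw w w0)) grad0 sub0r robust_path_tilt.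
- move=> Iw; apply: path_points_ext => w w0.
  by rewrite (proj_tilt _ (Iw w w0)) (central_path_tilt X a0 w0 (phiK _ phixR)).
- move=> lam x lam0 _ [x0 xS] k Ik.
  have phix j : (phi (x j) < +oo)%E.
    elim: j => [|j phixj]; first by rewrite x0.
    have := xS j; rewrite (central_path_tilt X a0 (lam0 j) (phiK _ phixj)).
    exact: argmin_tilt_dom.
  have := xS k; rewrite (central_path_tilt X a0 (lam0 k) (phiK _ (phix k))) => ax.
  rewrite proj_tilt //; apply/seteqP; split=> [y ay|y -> //].
  exact: (argmin_tilt_unique X_convex phi_ge0 strict dom ay ax).
Qed.
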